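(* The space $C(\mathbb N^* )$ is not $(1,\aleph_2)$-injective.
   Context: $\mathbb N^*=\beta\mathbb N\setminus\mathbb N$ is the growth of the integers in the Stone--Čech compactification, and $C(\mathbb N^* )$ is the Banach space of real-valued continuous functions on it with the sup norm (isometric to $\ell_\infty/c_0$). All Banach spaces are real, ''operator'' means bounded linear map, ''subspace'' means closed linear subspace, and $\operatorname{dens}(X)$ is the smallest cardinality of a dense subset of $X$. For an uncountable cardinal $\aleph$, a Banach space $E$ is $(1,\aleph)$-injective if for every Banach space $X$ with $\operatorname{dens}(X)<\aleph$ and every subspace $Y\subset X$, every operator $t:Y\to E$ has an extension to an operator $T:X\to E$ with $\|T\|\leq\|t\|$. *)

(* Defs.v *)
From HB Require Import structures.
From mathcomp Require Import all_boot all_order all_algebra.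
From mathcomp Require Import all_classical reals topology normedtype sequences.
From mathcomp Require Import ring.

Set Implicit Arguments.
Unset Strict Implicit.
Unset Printing Implicit Defensive.

Import Order.TTheory GRing.Theory Num.Theory.
Import numFieldNormedType.Exports.

Local Open Scope classical_set_scope.
Local Open Scope card_scope.
Local Open Scope ring_scope.

Definition card_lt T U (A : set T) (B : set U) : Prop :=
  (A #<= B) /\ ~ (B #<= A).
Notation "A '#<' B" := (card_lt A B) (at level 79) : card_scope.

Lemma card_min (I : Type) (V : I -> Type) (D : forall i, set (V i)) :
  inhabited I -> exists i, forall j, D i #<= D j.
Proof.
move=> [i0].
pose P (G : set (forall i, V i)) :=
  (forall g, G g -> forall i, D i (g i)) /\
  (forall g h, G g -> G h -> forall i, g i = h i -> g = h).
have [G [[GD Ginj] Gmax]] : exists G, P G /\ forall B, G `<` B -> ~ P B.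
  apply: Zorn_bigcup => F FP totF; split.
    by move=> g [X FX Xg]; have [+ _] := FP _ FX; apply.
  move=> g h [X FX Xg] [Y FY Yh].
  have [XY|YX] := totF _ _ FX FY.
    by have [_] := FP _ FY; apply => //; exact: XY.
  by have [_] := FP _ FX; apply => //; exact: YX.
have [i Gi] : exists i, forall x, D i x -> exists2 g, G g & g i = x.
  apply: contrapT => /forallNP H.
  have H' i : exists x, D i x /\ forall g, G g -> g i <> x.
    have /existsNP[x /not_implyP[Dx nx]] := H i.
    by exists x; split => // g Gg gx; apply: nx; exists g.
  pose k i := projT1 (cid (H' i)).
  have kP i : D i (k i) /\ forall g, G g -> g i <> k i := projT2 (cid (H' i)).
  apply: (Gmax (G `|` [set k])).
    split; first by move=> g Gg; left.
    by move=> /(_ k (or_intror erefl)) Gk; have [_ /(_ _ Gk)] := kP i0.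
  split.
    by move=> g [/GD//|-> i]; have [] := kP i.
  move=> g h [Gg|->] [Gh|->] i //.
  - exact: Ginj.
  - by have [_ /(_ _ Gg)] := kP i.
  - by move=> kh; have [_ /(_ _ Gh)] := kP i; rewrite kh.
exists i => j.
apply: (@card_le_trans _ _ _ G).
  apply: (@card_le_trans _ _ _ ((fun g : forall i, V i => g i) @` G)).
    by apply: subset_card_le => x /Gi[g Gg <-]; exists g.
  exact: card_image_le.
have /card_eqPle[_] : (fun g : forall i, V i => g j) @` G #= G.
  apply: inj_card_eq => g h /set_mem Gg /set_mem Gh; exact: Ginj.
move=> GI; apply: (card_le_trans GI); apply: subset_card_le => _ [g /GD Dg <-].
exact: Dg.
Qed.

Lemma card_le_total T U (A : set T) (B : set U) : A #<= B \/ B #<= A.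
Proof.
pose V (b : bool) : Type := if b then T else U.
pose D (b : bool) : set (V b) := if b as b' return set (V b') then A else B.
have [[] H] := @card_min bool V D (inhabits true).
- by left; exact: (H false).
- by right; exact: (H true).
Qed.

Definition is_card_succ T U (A : set T) (B : set U) : Prop :=
  (A #< B) /\ forall (V : Type) (C : set V), A #< C -> B #<= C.

Lemma card_succ_ex T (A : set T) : exists B : set (set T), is_card_succ A B.
Proof.
have AP : A #< [set: set T].
  split.
    apply: (@card_le_trans _ _ _ (set1 @` A)).
      have /card_eqPle[_] // : set1 @` A #= A.
      by apply: inj_card_eq => x y _ _ /seteqP[/(_ x erefl)].
    exact: card_leT.
  move=> /card_leP[f].
  pose g (X : set T) : T := val (f (SigSub (mem_set (I : [set: set T] X)))).
  have ginj X Y : g X = g Y -> X = Y.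
    by move=> /val_inj /inj; rewrite !inE => /(_ Logic.I Logic.I) [].
  pose E : set T := [set x | exists2 X : set T, g X = x & ~ X x].
  have [Eg|nEg] := pselect (E (g E)).
    by have [X /ginj XE nX] := Eg; apply: nX; rewrite XE.
  by apply: (nEg); exists E.
have [[B AB] Bmin] := @card_min {B : set (set T) | A #< B} (fun=> set T)
  (@sval _ _) (inhabits (exist _ setT AP)).
exists B; split => // V C [AC CA].
have [//|CB] := card_le_total B C.
have /card_subP[C' C'C _] := CB.
have [C'A AC'] : A #< C'.
  split; first by rewrite (card_le_eqr C'C).
  by rewrite (card_le_eql C'C).
rewrite -(card_le_eqr C'C).
exact: (Bmin (exist _ C' _)).
Qed.

Definition card_succ T (A : set T) : set (set T) :=
  projT1 (cid (card_succ_ex A)).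

Lemma card_succP T (A : set T) : is_card_succ A (card_succ A).
Proof. exact: projT2 (cid (card_succ_ex A)). Qed.

Fixpoint aleph_type (n : nat) : Type :=
  if n is n'.+1 then set (aleph_type n') else nat.

(* A set of cardinality aleph_n. *)
Fixpoint aleph (n : nat) : set (aleph_type n) :=
  match n return set (aleph_type n) with
  | 0%N => [set: nat]
  | n'.+1 => card_succ (@aleph n')
  end.
Arguments aleph n : clear implicits.

Section density.
Variable X : topologicalType.

Definition is_density (D : set X) : Prop :=
  dense D /\ forall D' : set X, dense D' -> D #<= D'.

Lemma density_ex : exists D, is_density D.
Proof.
have dT : dense [set: X] by move=> O ? _; rewrite setIT.
have [[D dD] Dmin] := @card_min {D : set X | dense D} (fun=> X)
  (@sval _ _) (inhabits (exist _ setT dT)).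
by exists D; split => // D' dD'; exact: (Dmin (exist _ D' dD')).
Qed.

(* A dense subset of smallest cardinality: its cardinality is dens(X). *)
Definition dens : set X := projT1 (cid density_ex).

Lemma densP : is_density dens. Proof. exact: projT2 (cid density_ex). Qed.

End density.
Arguments dens X : clear implicits.

(* The Stone-Cech compactification of the discrete space nat, as the space of
   ultrafilters on nat with base of open sets [set p | p A]; n is identified
   with the principal ultrafilter betaN_of n. *)
Record betaN := BetaN {
  ultra :> set nat -> Prop;
  ultraP : UltraFilter ultra
}.
#[global] Existing Instance ultraP.

HB.instance Definition _ := gen_eqMixin betaN.
HB.instance Definition _ := gen_choiceMixin betaN.

Lemma betaN_eq (p q : betaN) : ultra p = ultra q -> p = q.
Proof.
case: p q => p pU [q qU] /= pq; rewrite pq in pU *.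
by congr BetaN; exact: Prop_irrelevance.
Qed.

Lemma betaN_cover : \bigcup_(A in [set: set nat]) [set p : betaN | p A] = setT.
Proof.
rewrite -subTset => p _; exists setT => //=.
exact: filterT.
Qed.

Lemma betaN_join (A B : set nat) (p : betaN) :
  [set: set nat] A -> [set: set nat] B -> p A -> p B ->
  exists C, [/\ [set: set nat] C, p C &
    [set q : betaN | q C] `<=` [set q : betaN | q A] `&` [set q : betaN | q B]].
Proof.
move=> _ _ pA pB; exists (A `&` B); split => //.
  exact: filterI.
move=> q /= qAB; by split => /=; apply: filterS qAB => x [].
Qed.

HB.instance Definition _ :=
  isBaseTopological.Build betaN betaN_cover betaN_join.

Definition betaN_of (n : nat) : betaN := BetaN (principal_filter_ultra n).

Lemma betaN_open (A : set nat) : open [set p : betaN | p A].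
Proof.
exists [set A] => //.
by rewrite bigcup_set1.
Qed.

Lemma betaN_nbhs (p : betaN) (U : set betaN) :
  nbhs p U <-> exists2 A, p A & [set q : betaN | q A] `<=` U.
Proof.
split; last first.
  move=> [A pA AU]; rewrite nbhsE; exists [set q : betaN | q A] => //.
  by split => //; exact: betaN_open.
rewrite nbhsE => -[V [[D _ DV] Vp] VU].
have : (\bigcup_(A in D) [set q : betaN | q A]) p by rewrite DV.
move=> [A DA pA]; exists A => // q qA; apply: VU; rewrite -DV.
by exists A.
Qed.

Lemma betaN_setC (p : betaN) (A : set nat) : p (~` A) <-> ~ p A.
Proof.
split => [pC pA|nA].
  by have /filter_ex[x []] : ultra p (A `&` ~` A) by exact: filterI.
by have [] := in_ultra_setVsetC A (ultraP p).
Qed.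

Lemma betaN_hausdorff : hausdorff_space betaN.
Proof.
move=> p q pq; apply: betaN_eq; apply/seteqP.
have sub (r s : betaN) : cluster (nbhs r) s -> ultra r `<=` ultra s.
  move=> rs A rA; apply: contrapT => /betaN_setC sA.
  have [||x [/= xA /betaN_setC]//] :=
    rs [set t : betaN | t A] [set t : betaN | t (~` A)].
  - by apply/betaN_nbhs; exists A.
  - by apply/betaN_nbhs; exists (~` A).
split; first exact: sub.
apply: sub => A B qA pB; have [x [Bx Ax]] := pq _ _ pB qA.
by exists x.
Qed.

Lemma betaN_compact : compact [set: betaN].
Proof.
rewrite compact_ultra => F FU _.
pose p : set_system nat := [set A | F [set q : betaN | q A]].
have pF : ProperFilter p.
  apply: Build_ProperFilter_ex.
    move=> A pA; have [q /= qA] := @filter_ex _ F _ _ pA.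
    exact: filter_ex qA.
  split.
  - by apply: (@filterS _ F _ setT) => [q _|]; exact: filterT.
  - move=> A B pA pB; apply: (@filterS _ F) (@filterI _ F _ _ _ pA pB).
    move=> q [/= qA qB].
    exact: filterI.
  - move=> A B AB; rewrite /p/=; apply: filterS => q /= qA.
    exact: filterS qA.
have pU : UltraFilter p.
  split => // G GF pG; apply/seteqP; split => // A GA.
  have [//|FnA] := in_ultra_setVsetC [set q : betaN | q A] FU.
  have /pG GnA : p (~` A) by apply: filterS FnA => q /= /betaN_setC.
  by have /filter_ex[x []] : G (A `&` ~` A) by exact: filterI.
exists (BetaN pU); split => // U /betaN_nbhs[A pA AU].
exact: (@filterS _ F) AU pA.
Qed.

Lemma betaN_of_inj : injective betaN_of.
Proof.
move=> m n /(congr1 ultra) /= mn.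
have : principal_filter m [set m] by apply/principal_filterP.
by rewrite mn => /principal_filterP.
Qed.

Lemma betaN_of_open (n : nat) : open [set betaN_of n].
Proof.
rewrite (_ : [set _] = [set p : betaN | p [set n]]); first exact: betaN_open.
apply/seteqP; split => [p ->|p /= pn]; first by apply/principal_filterP.
apply: betaN_eq => /=; have -> : ultra p = principal_filter n.
  apply: (@max_filter _ _ (principal_filter_ultra n)).
  by move=> A /principal_filterP An; apply: filterS pn => x ->.
by [].
Qed.

Lemma betaN_of_dense : dense (range betaN_of).
Proof.
move=> U [p Up] oU.
have /betaN_nbhs[A pA AU] : nbhs p U by exact: open_nbhs_nbhs.
have [n An] := filter_ex pA.
by exists (betaN_of n); split; [apply: AU; apply/principal_filterP|exists n].
Qed.

(* Universal property of the Stone-Cech compactification of the discrete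
   space nat; the extension is unique by betaN_of_dense. *)
Lemma betaN_extension (K : topologicalType) (f : nat -> K) :
  compact [set: K] -> hausdorff_space K ->
  exists2 g : betaN -> K, continuous g & forall n, g (betaN_of n) = f n.
Proof.
move=> cK hK.
have lim_ex (p : betaN) : exists y : K, fmap f (ultra p) --> y.
    have [y [_ fy]] := cK (fmap f (ultra p)) _ (@filterT _ (fmap f (ultra p)) _).
  exists y => U Uy.
  have [//|/= nU] := in_ultra_setVsetC (f @^-1` U) (ultraP p).
  by have [x []] := fy (~` U) U nU Uy.
pose g p := projT1 (cid (lim_ex p)).
have gP p : fmap f (ultra p) --> g p := projT2 (cid (lim_ex p)).
exists g; last first.
  move=> n; apply: contrapT => /eqP gf.
  have := hK; rewrite open_hausdorff => /(_ _ _ gf).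
  move=> [[U V] /= [/set_mem gU /set_mem fV] [oU oV /eqP UV]].
  have /principal_filterP Ufn : principal_filter n (f @^-1` U).
    by apply: (gP (betaN_of n)); exact: open_nbhs_nbhs.
  by have : (U `&` V) (f n) by []; rewrite UV.
move=> p W gW.
have [V gV VW] := @compact_regular K (g p) setT hK cK filterT _ gW.
have pV : p (f @^-1` V) by exact: gP.
apply/betaN_nbhs; exists (f @^-1` V) => // q /= qV.
apply: VW => /= U gqU.
have qU : q (f @^-1` U) by exact: gP.
have /filter_ex[n [Vn Un]] : ultra q ((f @^-1` V) `&` (f @^-1` U)).
  exact: filterI.
by exists (f n).
Qed.

(* The coercion from sets to types equips it with the subspace topology. *)
Definition Nstar : set betaN := ~` range betaN_of.

Lemma Nstar_compact : compact [set: Nstar].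
Proof.
move=> F FF _.
pose G := (fun x : Nstar => val x) @ F.
have GT : G setT by exact: filterT.
have [p [_ Gp]] := betaN_compact _ GT.
have Np : Nstar p.
  move=> [n _ np].
  have Gn : G (~` [set betaN_of n]).
    apply: (@filterS _ F _ setT) filterT => -[q /= /set_mem qN] _ qn.
    by apply: qN; exists n.
  have pn : nbhs p [set betaN_of n].
    by rewrite -np; apply: open_nbhs_nbhs; split => //; exact: betaN_of_open.
  by have [q []] := Gp _ _ Gn pn.
exists (SigSub (mem_set Np)); split => // A U FA.
rewrite nbhsE => -[_ [[W oW <-] Wp] WU].
have GA : G (val @` A) by apply: (@filterS _ F _ A) FA => x Ax; exists x.
have pW : nbhs p W by exact: open_nbhs_nbhs.
have [_ [[x Ax <-] Wx]] := Gp _ _ GA pW.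
by exists x; split => //; exact: WU.
Qed.

Section continuous_functions.
Variables (K : topologicalType) (R : realType).

(* C(K); the compactness proof is what makes the sup norm well defined. *)
Record cfun (cK : compact [set: K]) := mkcfun {
  cfun_val :> K -> R;
  cfun_continuous : continuous cfun_val
}.

Variable cK : compact [set: K].
Local Notation CK := (cfun cK).

HB.instance Definition _ := gen_eqMixin CK.
HB.instance Definition _ := gen_choiceMixin CK.

Lemma cfunP (f g : CK) : f =1 g -> f = g.
Proof.
case: f g => f cf [g cg] /= /funext fg; rewrite fg in cf *.
by congr mkcfun; exact: Prop_irrelevance.
Qed.

Lemma cfun0_continuous : continuous (fun _ : K => 0 : R).
Proof. by move=> x; exact: cvg_cst. Qed.

Lemma cfunD_continuous (f g : CK) : continuous (fun x : K => f x + g x).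
Proof. by move=> x; apply: cvgD; exact: cfun_continuous. Qed.

Lemma cfunN_continuous (f : CK) : continuous (fun x : K => - f x).
Proof. by move=> x; apply: cvgN; exact: cfun_continuous. Qed.

Lemma cfunZ_continuous (a : R) (f : CK) : continuous (fun x : K => a * f x).
Proof.
by move=> x; apply: cvgM; [exact: cvg_cst|exact: cfun_continuous].
Qed.

Let cfun0 : CK := mkcfun cK cfun0_continuous.
Let cfunD (f g : CK) : CK := mkcfun cK (@cfunD_continuous f g).
Let cfunN (f : CK) : CK := mkcfun cK (@cfunN_continuous f).
Let cfunZ (a : R) (f : CK) : CK := mkcfun cK (@cfunZ_continuous a f).

Let cfunDA : associative cfunD.
Proof. by move=> f g h; apply: cfunP => x; exact: addrA. Qed.
Let cfunDC : commutative cfunD.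
Proof. by move=> f g; apply: cfunP => x; exact: addrC. Qed.
Let cfun0D : left_id cfun0 cfunD.
Proof. by move=> f; apply: cfunP => x; exact: add0r. Qed.
Let cfunND : left_inverse cfun0 cfunN cfunD.
Proof. by move=> f; apply: cfunP => x; exact: addNr. Qed.

HB.instance Definition _ :=
  GRing.isZmodule.Build CK cfunDA cfunDC cfun0D cfunND.

Let cfunZA (a b : R) (f : CK) : cfunZ a (cfunZ b f) = cfunZ (a * b) f.
Proof. by apply: cfunP => x; exact: mulrA. Qed.
Let cfun1Z : left_id 1 cfunZ.
Proof. by move=> f; apply: cfunP => x; exact: mul1r. Qed.
Let cfunZDr : right_distributive cfunZ +%R.
Proof. by move=> a f g; apply: cfunP => x; exact: mulrDr. Qed.
Let cfunZDl (f : CK) : {morph cfunZ^~ f : a b / a + b}.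
Proof. by move=> a b; apply: cfunP => x; exact: mulrDl. Qed.

HB.instance Definition _ :=
  GRing.Zmodule_isLmodule.Build R CK cfunZA cfun1Z cfunZDr cfunZDl.

Lemma cfun0E x : (0 : CK) x = 0. Proof. by []. Qed.
Lemma cfunDE (f g : CK) x : (f + g) x = f x + g x. Proof. by []. Qed.
Lemma cfunNE (f : CK) x : (- f) x = - f x. Proof. by []. Qed.
Lemma cfunZE a (f : CK) x : (a *: f) x = a * f x. Proof. by []. Qed.

Definition sup_norm (f : CK) : R := sup (range (fun x : K => `|f x|)).

Let sup_norm_ub (f : CK) : has_ubound (range (fun x : K => `|f x|)).
Proof.
have /compact_bounded[M [_ fM]] : compact (f @` [set: K]).
  apply: continuous_compact => //.
  by apply/continuous_subspaceT; exact: cfun_continuous.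
exists (M + 1) => _ [x _ <-].
by apply: (fM (M + 1)); [rewrite ltrDl|exists x].
Qed.

Lemma ler_sup_norm (f : CK) x : `|f x| <= sup_norm f.
Proof. by apply: ub_le_sup; [exact: sup_norm_ub|exists x]. Qed.

Let sup_norm_empty (f : CK) : ~ ([set: K] !=set0) -> sup_norm f = 0.
Proof.
move=> K0; have r0 : range (fun x : K => `|f x| : R) = set0 :> set R.
  apply/seteqP; split => [y [x _ _]|y []].
  by case: K0; exists x.
by rewrite /sup_norm r0 sup0.
Qed.

Lemma sup_norm_ge0 (f : CK) : 0 <= sup_norm f.
Proof.
have [[x _]|K0] := pselect ([set: K] !=set0).
  exact: le_trans (ler_sup_norm f x).
by rewrite sup_norm_empty.
Qed.

Lemma sup_norm_le (f : CK) (M : R) :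
  0 <= M -> (forall x, `|f x| <= M) -> sup_norm f <= M.
Proof.
move=> M0 fM.
have [[x _]|K0] := pselect ([set: K] !=set0).
  by apply: ge_sup => [|_ [y _ <-]//]; exists `|f x|, x.
by rewrite sup_norm_empty.
Qed.

Let sup_normD (f g : CK) : sup_norm (f + g) <= sup_norm f + sup_norm g.
Proof.
apply: sup_norm_le => [|x]; first by rewrite addr_ge0 ?sup_norm_ge0.
by rewrite cfunDE (le_trans (ler_normD _ _))// lerD ?ler_sup_norm.
Qed.

Let sup_normZ (a : R) (f : CK) : sup_norm (a *: f) = `|a| * sup_norm f.
Proof.
apply/eqP; rewrite eq_le; apply/andP; split.
  apply: sup_norm_le => [|x]; first by rewrite mulr_ge0 ?sup_norm_ge0.
  by rewrite cfunZE normrM ler_wpM2l ?ler_sup_norm.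
have [->|a0] := eqVneq a 0; first by rewrite normr0 mul0r sup_norm_ge0.
rewrite -ler_pdivlMl ?normr_gt0//; apply: sup_norm_le => [|x].
  by rewrite mulr_ge0 ?invr_ge0 ?sup_norm_ge0.
by rewrite ler_pdivlMl ?normr_gt0// -normrM -cfunZE ler_sup_norm.
Qed.

Let sup_norm_eq0 (f : CK) : sup_norm f = 0 -> f = 0.
Proof.
move=> f0; apply: cfunP => x; apply/eqP; rewrite -normr_le0 -f0.
exact: ler_sup_norm.
Qed.

HB.instance Definition _ :=
  Lmodule_isNormed.Build R CK sup_normD sup_normZ sup_norm_eq0.

Lemma cfun_normE (f : CK) : `|f| = sup_norm f. Proof. by []. Qed.

Let cfun_complete (F : set_system CK) : ProperFilter F -> cauchy F -> cvg F.
Proof.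
move=> FF /cauchy_ballP Fc.
have cauchyE e : 0 < e -> exists2 A : set CK, F A &
    forall f g, A f -> A g -> `|f - g| < e.
  move=> e0; have /Fc := e0; rewrite near2E => -[[A B] /= [FA FB] AB].
  exists (A `&` B); first exact: filterI.
  by move=> f g [Af _] [_ Bg]; have := AB (f, g) (conj Af Bg); rewrite -ball_normE.
pose G x := (fun f : CK => f x) @ F.
have Gc x : cvg (G x).
  apply: R_complete; apply/cauchy_ballP => e e0.
  have [A FA Ae] := cauchyE _ e0.
  exists ((fun f : CK => f x) @` A, (fun f : CK => f x) @` A) => /=.
    by split; apply: (@filterS _ F _ A) FA => f Af; exists f.
  move=> [_ _] [/= [f Af <-] [g Ag <-]]; rewrite -ball_normE/=.
  by rewrite -cfunNE -cfunDE (le_lt_trans (ler_sup_norm _ _))// Ae.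
pose l x : R := lim (G x).
have Al e : 0 < e -> exists2 A : set CK, F A &
    forall f x, A f -> `|l x - f x| <= e.
  move=> e0; have [A FA Ae] := cauchyE _ e0; exists A => // f x Af.
  have Ffx : F [set g : CK | `|g x - f x| <= e].
    apply: (@filterS _ F _ A) FA => g Ag /=; rewrite -cfunNE -cfunDE.
    by rewrite (le_trans (ler_sup_norm _ _))// ltW// Ae.
  have cvgl : (fun g : CK => `|g x - f x|) @ F --> `|l x - f x|.
    by apply: cvg_norm; apply: cvgB; [exact: Gc|exact: cvg_cst].
  exact: (@closed_cvg _ _ F FF _ (fun y : R => y <= e) (@closed_le R e) Ffx _ cvgl).
have lc : continuous l.
  move=> x; apply/cvgrPdist_lt => e e0.
  have e30 : 0 < e / 3 by rewrite divr_gt0.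
  have [A FA Ae] := Al _ e30.
  have [f Af] := filter_ex FA.
  have /cvgrPdist_lt/(_ _ e30) := @cfun_continuous cK f x.
  apply: filterS => y fxy.
  rewrite (_ : l x - l y = (l x - f x) + ((f x - f y) + (f y - l y))); last first.
    by rewrite addrA subrKA addrA subrK.
  have -> : e = e / 3 + (e / 3 + e / 3) by field.
  apply: le_lt_trans (ler_normD _ _) _; apply: ler_ltD; first exact: Ae.
  apply: le_lt_trans (ler_normD _ _) _; apply: ltr_leD; first exact: fxy.
  by rewrite distrC Ae.
apply: (@cvgP _ _ (mkcfun cK lc)); apply/cvgrPdist_le => e e0.
have [A FA Ae] := Al _ e0.
apply: filterS FA => f Af; rewrite cfun_normE; apply: sup_norm_le => [|x].
  exact: ltW.
exact: Ae.
Qed.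

HB.instance Definition _ := Uniform_isComplete.Build CK cfun_complete.

End continuous_functions.
Arguments cfun {K} R cK.

Section subspaces.
Variables (R : realType) (X : normedModType R).

Definition lin_subspace (Y : submodClosed X) : Type := {x : X | x \in Y}.

Variable Y : submodClosed X.
Local Notation SY := (lin_subspace Y).

HB.instance Definition _ := SubType.on SY.
HB.instance Definition _ := [Choice of SY by <:].
HB.instance Definition _ := [SubChoice_isSubLmodule of SY by <:].

Let norm_val (y : SY) : R := `|val y|.

Let norm_valD (y z : SY) : norm_val (y + z) <= norm_val y + norm_val z.
Proof. by rewrite /norm_val raddfD ler_normD. Qed.

Let norm_valZ (a : R) (y : SY) : norm_val (a *: y) = `|a| * norm_val y.
Proof. by rewrite /norm_val linearZ normrZ. Qed.

Let norm_val_eq0 (y : SY) : norm_val y = 0 -> y = 0.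
Proof. by move/eqP; rewrite normr_eq0 => /eqP y0; apply: val_inj. Qed.

HB.instance Definition _ :=
  Lmodule_isNormed.Build R SY norm_valD norm_valZ norm_val_eq0.

Lemma norm_valE (y : SY) : `|y| = `|val y|. Proof. by []. Qed.

End subspaces.

Definition opnorm (R : realType) (V W : normedModType R) (f : V -> W) : R :=
  sup [set `|f x| | x in [set x : V | `|x| <= 1]].

Lemma ler_opnorm (R : realType) (V W : normedModType R) (f : {linear V -> W})
  (x : V) : bounded_fun_norm f -> `|f x| <= opnorm f * `|x|.
Proof.
move=> /(_ 1)[M fM].
have [->|x0] := eqVneq x 0; first by rewrite linear0 !normr0 mulr0.
have nx0 : 0 < `|x| by rewrite normr_gt0.
rewrite -ler_pdivrMr// mulrC.
have -> : `|x|^-1 * `|f x| = `|f (`|x|^-1 *: x)|.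
  by rewrite linearZ normrZ ger0_norm ?invr_ge0.
apply: ub_le_sup; first by exists M => _ [y y1 <-]; exact: fM.
exists (`|x|^-1 *: x) => //=.
by rewrite normrZ ger0_norm ?invr_ge0// mulVf// gt_eqF.
Qed.

(* E is (1, kappa)-injective, the cardinal kappa being given by a set of that
   cardinality. *)
Definition one_injective (R : realType) (U : Type) (kappa : set U)
    (E : completeNormedModType R) : Prop :=
  forall X : completeNormedModType R, dens X #< kappa ->
  forall Y : submodClosed X, closed [set x : X | x \in Y] ->
  forall t : {linear lin_subspace Y -> E}, bounded_fun_norm t ->
  exists T : {linear X -> E},
    [/\ bounded_fun_norm T,
        forall y : lin_subspace Y, T (val y) = t y &
        opnorm T <= opnorm t].

(* Main.v *)
(* Take a Luzin family: an uncountable almost disjoint family (A_i) of infinite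
   subsets of nat, indexed by an order with countable initial segments, such that
   for all i and n only finitely many j <= i satisfy A_i /\ A_j <= {0..n-1}. No
   subset of nat separates two uncountable subfamilies. Split the index set I
   into two uncountable pieces, with signs eps_i = 1 and eps_i = -1. Let X be
   C(alpha I), alpha I the one-point compactification of the discrete I, and let
   Y = c_0(I) be the functions vanishing at infinity. The clopen sets A_i^* of
   N^* being disjoint, e_i |-> eps_i 1_(A_i^* ) defines a norm-one operator
   t : Y -> C(N^* ). If T extends t with norm at most 1 and h = T(1), then
   |h - 2 eps_i 1_(A_i^* )| <= |1 - 2 e_i| = 1, so h >= 1 on A_i^* when
   eps_i = 1 and h <= -1 on A_i^* when eps_i = -1; by compactness some subset of
   nat separates the two pieces. *)
Require Import Defs.
From HB Require Import structures.
From mathcomp Require Import all_boot all_order all_algebra.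
From mathcomp Require Import finmap.
From mathcomp Require Import all_classical reals topology normedtype sequences.
From mathcomp Require Import lra.

Set Implicit Arguments.
Unset Strict Implicit.
Unset Printing Implicit Defensive.

Import Order.TTheory GRing.Theory Num.Theory.
Import numFieldNormedType.Exports.

Local Open Scope classical_set_scope.
Local Open Scope card_scope.
Local Open Scope ring_scope.

(** * Luzin families *)

Lemma exists_diagonal_set (G : set (set nat)) : infinite_set G -> countable G ->
  (forall B, G B -> infinite_set B) ->
  (forall B C, G B -> G C -> B <> C -> finite_set (B `&` C)) ->
  exists A : set nat, [/\ infinite_set A,
    forall B, G B -> finite_set (A `&` B) &
    forall n, finite_set [set B | G B /\ A `&` B `<=` `I_n]].
Proof.
move=> Ginf Gc GI Gad.
have /card_esym/card_set_bijP[b bb] := eq_card_nat Gc Ginf.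
have Gb i : G (b i) by apply: (set_bij_sub bb); exists i.
have binj i j : b i = b j -> i = j by apply: (set_bij_inj bb); rewrite inE.
have bG B : G B -> exists i, b i = B.
  by move=> GB; have [i _ <-] := set_bij_surj bb GB; exists i.
have a_ex k : exists a, [/\ b k a, (k <= a)%N & forall i, (i < k)%N -> ~ b i a].
  have : infinite_set (b k `\` (\bigcup_(i in `I_k) (b k `&` b i) `|` `I_k)).
    apply: infinite_setD; first exact: GI.
    rewrite finite_setU; split; last exact: finite_II.
    apply: bigcup_finite; first exact: finite_II.
    by move=> i /= ik; apply: Gad => // /binj ki; rewrite ki ltnn in ik.
  move=> /infinite_setN0[a [ba /not_orP[nb /negP]]].
  rewrite -leqNgt => ka; exists a; split => // i ik bi.
  by apply: nb; exists i.
have [a aP] := choice a_ex.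
exists (range a); split.
- move=> ra; apply: infinite_nat.
  apply: (@sub_finite_set _ _ (\bigcup_(m in range a) `I_m.+1)).
    move=> k _; exists (a k); first by exists k.
    by rewrite /= ltnS; have [] := aP k.
  by apply: bigcup_finite => // m _; exact: finite_II.
- move=> _ /bG[j <-].
  apply: (@sub_finite_set _ _ (a @` `I_j.+1)); last exact/finite_image/finite_II.
  move=> _ [[k _ <-] bj]; exists k => //=; rewrite ltnS leqNgt; apply/negP => jk.
  by have [_ _ /(_ j jk)] := aP k.
- move=> n.
  apply: (@sub_finite_set _ _ (b @` `I_n)); last exact/finite_image/finite_II.
  move=> _ [/bG[k <-] bn]; exists k => //=.
  have [bk ka _] := aP k; apply: leq_ltn_trans ka _.
  by apply: bn; split => //; exists k.
Qed.

Lemma column_family : exists Z : set (set nat), [/\ infinite_set Z, countable Z,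
  forall B, Z B -> infinite_set B &
  forall B C, Z B -> Z C -> B <> C -> finite_set (B `&` C)].
Proof.
pose col (i : nat) : set nat := range (fun j => choice.pickle (i, j : nat)).
have col_inj (i k : nat) n : col i n -> col k n -> i = k.
  by move=> [j _ <-] [l _] /(pcan_inj choice.pickleK)[].
exists (range col); split.
- apply/infiniteP; rewrite -(card_le_eql (B := [set: nat]) (A := range col)) //.
  apply: inj_card_eq => i k _ _ ik; apply: (@col_inj i k (choice.pickle (i, 0%N))).
    by exists 0%N.
  by rewrite -ik; exists 0%N.
- exact: card_image_le.
- move=> _ [i _ <-]; apply/infiniteP.
  rewrite -(card_le_eql (B := [set: nat]) (A := col i)) //.
  by apply: inj_card_eq => j l _ _ /(pcan_inj choice.pickleK)[].
- move=> _ _ [i _ <-] [k _ <-] ik.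
  rewrite (_ : _ `&` _ = set0) //; apply/seteqP; split => // n [ni nk].
  by apply: ik; rewrite (col_inj _ _ _ ni nk).
Qed.

Lemma countable_setU T (A B : set T) :
  countable A -> countable B -> countable (A `|` B).
Proof.
by move=> Ac Bc; rewrite -bigcup2E; apply: bigcup_countable => // -[|[|n]] _ //=.
Qed.

(* [below i] is an initial segment with largest element [i] of a linear order
   on [I] all of whose initial segments are countable. *)
Record luzin_system (I : Type) (A : I -> set nat) (below : I -> set I) : Prop := {
  luzin_uncountable : ~ countable [set: I];
  luzin_infinite : forall i, infinite_set (A i);
  luzin_disjoint : forall i j, i <> j -> finite_set (A i `&` A j);
  luzin_below_refl : forall i, below i i;
  luzin_below_countable : forall i, countable (below i);
  luzin_below_total : forall i j, below i `<=` below j \/ below j `<=` below i;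
  luzin_below_finite : forall i n,
    finite_set [set j | below i j /\ A i `&` A j `<=` `I_n]
}.

(* The family is built by Zorn's lemma: a node carries a set, the family of all
   sets preceding it (a fixed seed family [Z] and itself included), and
   infinitely many private codes in [K]. The codes give [I * nat #<= K] without
   cardinal arithmetic, and the infinite [Z] keeps the diagonal construction
   applicable at the first steps. *)
Record luzin_node (U : Type) := LuzinNode {
  node_set : set nat;
  node_below : set (set nat);
  node_code : nat -> U
}.
Arguments node_set {U} _.

HB.instance Definition _ U := gen_eqMixin (luzin_node U).
HB.instance Definition _ U := gen_choiceMixin (luzin_node U).

Section luzin_existence.
Variables (U : Type) (K : set U) (Z : set (set nat)).
Hypothesis K_uncountable : ~ countable K.
Hypothesis Z_infinite : infinite_set Z.
Hypothesis Z_countable : countable Z.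
Hypothesis Z_sets : forall B, Z B -> infinite_set B.
Hypothesis Z_disjoint :
  forall B C, Z B -> Z C -> B <> C -> finite_set (B `&` C).

Local Notation node := (luzin_node U).

Definition node_ok (p : node) : Prop :=
  let A := node_set p in let S := node_below p in
  [/\ infinite_set A, S A, Z `<=` S & countable S] /\
  [/\ forall B, S B -> B <> A -> finite_set (A `&` B),
      forall n, finite_set [set B | S B /\ A `&` B `<=` `I_n],
      injective (node_code p) & forall i, K (node_code p i)].

Definition nodes_compatible (p q : node) : Prop :=
  (node_below p `<=` node_below q \/ node_below q `<=` node_below p) /\
  (p = q \/ node_set p <> node_set q /\
    forall i j, node_code p i <> node_code q j).

Definition luzin_tree (C : set node) : Prop :=
  [/\ forall p, C p -> node_ok p,
      forall p q, C p -> C q -> nodes_compatible p q &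
      forall p, C p -> node_below p `<=` Z `|` node_set @` C].

Lemma luzin_tree_maximal :
  exists C, luzin_tree C /\ forall D, C `<` D -> ~ luzin_tree D.
Proof.
apply: Zorn_bigcup => F FP totF; split.
- by move=> p [X FX Xp]; have [+ _ _] := FP _ FX; exact.
- move=> p q [X FX Xp] [Y FY Yq]; have [XY|YX] := totF _ _ FX FY.
    by have [_ + _] := FP _ FY; apply => //; exact: XY.
  by have [_ + _] := FP _ FX; apply => //; exact: YX.
- move=> p [X FX Xp] B pB; have [_ _ /(_ _ Xp _ pB)] := FP _ FX.
  by move=> [ZB|[q Xq <-]]; [left|right; exists q => //; exists X].
Qed.

Lemma node_sets_disjoint p q : node_ok p -> node_ok q ->
  nodes_compatible p q -> node_set p <> node_set q ->
  finite_set (node_set p `&` node_set q).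
Proof.
move=> [[_ pp _ _] [pad _ _ _]] [[_ qq _ _] [qad _ _ _]] [[pq|qp] _] npq.
  by rewrite setIC; apply: qad => //; exact: pq.
by apply: pad; [exact: qp|exact: nesym].
Qed.

Lemma fresh_code (C : set node) : countable C ->
  exists c : nat -> U, [/\ injective c, forall i, K (c i) &
    forall p, C p -> forall i j, c i <> node_code p j].
Proof.
move=> Cc; pose V := \bigcup_(p in C) range (node_code p).
have : infinite_set (K `\` V).
  move=> KV; apply: K_uncountable.
  apply: (@sub_countable _ _ _ (V `|` (K `\` V))).
    by apply: subset_card_le => x Kx; have [Vx|nVx] := pselect (V x); [left|right].
  apply: countable_setU; last exact: finite_set_countable.
  by apply: bigcup_countable => // p _; exact: card_image_le.
move=> /infiniteP/card_leP/unsquash f.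
have fP (n : nat) : (K `\` V) (val (f (to_setT n))) := set_mem (valP _).
exists (fun n => val (f (to_setT n))); split.
- by move=> m n /val_inj /inj; rewrite !inE => /(_ Logic.I Logic.I) [].
- by move=> n; have [] := fP n.
- by move=> p Cp i j ij; have [_] := fP i; apply; exists p => //; exists j.
Qed.

Lemma luzin_tree_uncountable (C : set node) : luzin_tree C ->
  (forall D, C `<` D -> ~ luzin_tree D) -> ~ countable C.
Proof.
move=> [Cok Ccomp Cbelow] Cmax Cc.
pose G := Z `|` node_set @` C.
have Gc : countable G.
  apply: countable_setU => //.
  by apply: (sub_countable _ Cc); exact: card_image_le.
have ZadC B p : Z B -> C p -> B <> node_set p -> finite_set (B `&` node_set p).
  move=> ZB Cp Bp; have [[_ _ Zp _] [pad _ _ _]] := Cok _ Cp.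
  by rewrite setIC; apply: pad => //; exact: Zp.
have [||||A [Ainf Aad Afin]] := @exists_diagonal_set G.
- by apply: sub_infinite_set Z_infinite; left.
- exact: Gc.
- by move=> B [/Z_sets//|[p /Cok[[pinf _ _ _] _] <-]].
- move=> B D [ZB|[p Cp <-]] [ZD|[q Cq <-]] BD.
  + exact: Z_disjoint.
  + exact: ZadC.
  + by rewrite setIC; apply: ZadC => //; exact: nesym.
  + by apply: node_sets_disjoint => //; [exact: Cok|exact: Cok|exact: Ccomp].
have nGA : ~ G A by move=> /Aad; rewrite setIid.
have [c [cinj cK cC]] := fresh_code Cc.
pose r := LuzinNode A (A |` G) c.
have nCr : ~ C r by move=> Cr; apply: nGA; right; exists r.
have rok : node_ok r.
  split; split => //=.
  - by left.
  - by move=> B ZB; right; left.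
  - exact: countable_setU.
  - by move=> B [->//|GB] _; exact: Aad.
  - move=> n; apply: sub_finite_set (Afin n) => B [[->|//] AA].
    exfalso; apply: Ainf; apply: sub_finite_set (finite_II n).
    by rewrite setIid in AA.
have rcomp p : C p -> nodes_compatible p r.
  move=> Cp; split.
    by left => B /(Cbelow _ Cp) GB; right.
  right; split => /=.
    by move=> pA; apply: nGA; right; exists p.
  by move=> i j /esym; exact: cC.
have compC p q : nodes_compatible p q -> nodes_compatible q p.
  move=> [pq pq']; split; first by case: pq; [right|left].
  case: pq' => [->|[npq ncpq]]; [by left|right; split; first exact: nesym].
  by move=> i j /esym; exact: ncpq.
apply: (Cmax (r |` C)).
  by split; [move=> p Cp; right|move=> /(_ r (or_introl erefl))].
split.
- by move=> p [->//|/Cok].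
- move=> p q [->|Cp] [->|Cq].
  + by split; left.
  + by apply: compC; exact: rcomp.
  + exact: rcomp.
  + exact: Ccomp.
- move=> p [->|Cp] B /=.
    move=> [->|[ZB|[q Cq <-]]]; [|by left|].
      by right; exists r => //; left.
    by right; exists q => //; right.
  move=> /(Cbelow _ Cp)[ZB|[q Cq <-]]; first by left.
  by right; exists q => //; right.
Qed.

End luzin_existence.

Lemma luzin_system_exists U (K : set U) : ~ countable K ->
  exists (I : choiceType) (A : I -> set nat) (below : I -> set I),
    luzin_system A below /\ [set: I * nat] #<= K.
Proof.
move=> nK; have [Z [Zinf Zc Zsets Zad]] := column_family.
have [C [CT Cmax]] := luzin_tree_maximal K Z.
have nC := luzin_tree_uncountable nK Zinf Zc Zsets Zad CT Cmax.
have [Cok Ccomp _] := CT.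
pose I : choiceType := {p : luzin_node U | p \in C}.
have CI (i : I) : C (val i) by exact: set_mem (valP i).
exists I, (fun i => node_set (val i)),
  (fun i => [set j | node_below (val i) (node_set (val j))]).
have Ainj (i j : I) : node_set (val i) = node_set (val j) -> i = j.
  by have [_ [/val_inj//|[nij _ /nij]]] := Ccomp _ _ (CI i) (CI j).
have preimI (P : set (set nat)) :
    [set j : I | P (node_set (val j))] #<= P.
  have /card_eqPle[_] : (fun j : I => node_set (val j)) @`
      [set j : I | P (node_set (val j))] #= [set j : I | P (node_set (val j))].
    by apply: inj_card_eq => j k _ _; exact: Ainj.
  move=> /card_le_trans; apply; apply: subset_card_le => _ [j Pj <-].
  exact: Pj.
split; first split.
- by move=> Ic; apply: nC; move: Ic; rewrite (eq_countable (card_setT _)).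
- by move=> i; have [[]] := Cok _ (CI i).
- move=> i j ij; apply: (node_sets_disjoint (K := K) (Z := Z)).
  + exact: Cok.
  + exact: Cok.
  + exact: Ccomp.
  + by move=> /Ainj.
- by move=> i; have [[]] := Cok _ (CI i).
- move=> i; have [[_ _ _ ci] _] := Cok _ (CI i).
  exact: sub_countable (preimI _) ci.
- move=> i j; have [[ij|ji] _] := Ccomp _ _ (CI i) (CI j).
    by left => k /ij.
  by right => k /ji.
- move=> i n; have [_ [_ /(_ n) fn _ _]] := Cok _ (CI i).
  exact: card_le_finite (preimI _) fn.
have /card_eqPle[_] : (fun x : I * nat => node_code (val x.1) x.2) @`
    [set: I * nat] #= [set: I * nat].
  apply: inj_card_eq => -[i m] [j n] _ _ /= ij.
  have [_ [/val_inj eij|[_ /(_ m n)/(_ ij)//]]] := Ccomp _ _ (CI i) (CI j).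
  rewrite -eij in ij *; have [_ [_ _ cinj _]] := Cok _ (CI i).
  by rewrite (cinj _ _ ij).
move=> /card_le_trans; apply; apply: subset_card_le => _ [[i n] _ <-].
by have [_ [_ _ _]] := Cok _ (CI i).
Qed.

Lemma finite_nat_bounded (S : set nat) : finite_set S -> exists n, S `<=` `I_n.
Proof.
move=> /finite_seqP[s ->]; exists (\max_(i <- s) i).+1 => i /= si.
by rewrite ltnS; exact: leq_bigmax_seq.
Qed.

Lemma uncountable_pigeonhole T (P : set T) (S : T -> nat -> Prop) :
  ~ countable P -> (forall x, P x -> exists n, S x n) ->
  exists n, ~ countable [set x | P x /\ S x n].
Proof.
move=> nP PS; apply: contrapT => /forallNP cPS; apply: nP.
apply: (@sub_countable _ _ _ (\bigcup_n [set x | P x /\ S x n])).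
  by apply: subset_card_le => x Px; have [n Sn] := PS _ Px; exists n.
by apply: bigcup_countable => // n _; have /contrapT := cPS n.
Qed.

Section luzin_system_theory.
Variables (I : Type) (A : I -> set nat) (below : I -> set I).
Hypothesis AL : luzin_system A below.

Lemma luzin_inseparable (P Q : set I) (C : set nat) :
  ~ countable P -> ~ countable Q ->
  (forall i, P i -> finite_set (A i `\` C)) ->
  (forall i, Q i -> finite_set (A i `&` C)) -> False.
Proof.
move=> nP nQ PC QC.
have [m nP'] := uncountable_pigeonhole nP (fun i Pi => finite_nat_bounded (PC i Pi)).
have [n nQ'] := uncountable_pigeonhole nQ (fun i Qi => finite_nat_bounded (QC i Qi)).
set P' := [set i | _] in nP'; set Q' := [set i | _] in nQ'.
have PQ i j : P' i -> Q' j -> A j `&` A i `<=` `I_(maxn m n).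
  move=> [_ im] [_ jn] k [jk ik]; rewrite /= leq_max.
  by have [Ck|nCk] := pselect (C k); [rewrite jn ?orbT|rewrite im].
have /infiniteP/card_leP/unsquash f : infinite_set P'.
  by move=> /finite_set_countable.
pose p (k : nat) : I := val (f (to_setT k)).
have pP k : P' (p k) := set_mem (valP (f (to_setT k))).
have pinj : injective p.
  by move=> k l /val_inj /inj; rewrite !inE => /(_ Logic.I Logic.I) [].
have [j [Qj nbj]] : exists j, Q' j /\ forall k, ~ below (p k) j.
  apply: contrapT => /forallNP H; apply: nQ'.
  apply: (@sub_countable _ _ _ (\bigcup_k below (p k))).
    apply: subset_card_le => j Qj; apply: contrapT => nj; apply: (H j).
    by split => // k bj; apply: nj; exists k.
  by apply: bigcup_countable => // k _; exact: luzin_below_countable AL _.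
have bp k : below j (p k).
  have [jk|kj] := luzin_below_total AL j (p k).
    by case: (nbj k); apply: jk; exact: luzin_below_refl AL _.
  by apply: kj; exact: luzin_below_refl AL _.
apply: infinite_nat.
have /(sub_finite_set (A := range p))fp := luzin_below_finite AL j (maxn m n).
apply: card_le_finite (fp _); last first.
  by move=> _ [k _ <-]; split; [exact: bp|exact: PQ].
have /card_eqPle[_] // : range p #= [set: nat].
by apply: inj_card_eq => k l _ _; exact: pinj.
Qed.

Lemma luzin_split : exists k : nat,
  ~ countable [set i | A i k] /\ ~ countable [set i | ~ A i k].
Proof.
apply: contrapT => /forallNP H.
have Ainj i j : A i = A j -> i = j.
  move=> Aij; apply: contrapT => /(luzin_disjoint AL).
  by rewrite Aij setIid; exact: luzin_infinite AL _.
pose S := [set k | ~ countable [set i | A i k]].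
apply: (luzin_uncountable AL).
apply: (@sub_countable _ _ _
    ([set i | A i = S] `|` \bigcup_k [set i | ~ (A i k <-> S k)])).
  apply: subset_card_le => i _; have [Ai|nAi] := pselect (A i = S); first by left.
  right; apply: contrapT => nk; apply: nAi; apply/predeqP => k.
  by apply: contrapT => nkS; apply: nk; exists k.
apply: countable_setU.
  apply/countable_injP; exists (fun=> 0%N) => i j /set_mem/= iS /set_mem/= jS _.
  by apply: Ainj; rewrite iS.
apply: bigcup_countable => // k _.
have [Sk|nSk] := pselect (S k).
  have /contrapT : ~ ~ countable [set i | ~ A i k].
    by move=> nc; apply: (H k).
  apply: sub_countable; apply: subset_card_le => i ik Ai; apply: ik.
  by split.
have /contrapT : ~ ~ countable [set i | A i k] by [].
apply: sub_countable; apply: subset_card_le => i ik; apply: contrapT => nAi.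
by apply: ik; split.
Qed.

End luzin_system_theory.

(** * Clopen sets of N^* *)

Lemma cofinite_in_proper T (B : set T) :
  infinite_set B -> ProperFilter [set A | finite_set (B `\` A)].
Proof.
move=> Binf; apply: Build_ProperFilter_ex.
  move=> A FA; apply/set0P; apply/negP => /eqP A0; apply: Binf.
  by move: FA; rewrite /= A0 setD0.
split.
- by rewrite /= setDT.
- by move=> A A' FA FA'; rewrite /= setDIr finite_setU; split.
- by move=> A A' AA'; apply: sub_finite_set; exact: setDS.
Qed.

Lemma Nstar_infinite (x : Nstar) (B : set nat) : val x B -> infinite_set B.
Proof.
case: x => p /= /set_mem Np pB /finite_fsetP[F BF]; rewrite BF in pB.
suff [n pn] : exists n, p [set n].
  apply: Np; exists n => //; apply: betaN_eq => /=; apply/esym.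
  apply: (@max_filter _ _ (principal_filter_ultra n)).
  by move=> A /principal_filterP An; apply: filterS pn => k ->.
apply: contrapT => /forallNP np.
have : ultra p (\bigcap_(n in [set` F]) ~` [set n]).
  by apply: filter_bigI => n _; exact/betaN_setC.
move=> /(filterI pB)/filter_ex[n [Fn /(_ n Fn)]]; exact.
Qed.

Lemma Nstar_mem_infinite (B : set nat) :
  infinite_set B -> exists x : Nstar, val x B.
Proof.
move=> Binf; pose F := [set A | finite_set (B `\` A)].
have FF : ProperFilter F := cofinite_in_proper Binf.
have [G [GU FG]] := ultraFilterLemma FF.
have GN : Nstar (BetaN GU).
  move=> [n _ /(congr1 ultra)/= nG].
  have Gn : G [set n] by rewrite -nG; apply/principal_filterP.
  have /FG/(filterI Gn)/filter_ex[k [? ?]//] : F (~` [set n]).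
  by rewrite /F/= setDE setCK; exact: finite_setIr.
exists (SigSub (mem_set GN)) => /=; apply: FG.
by rewrite /F/= setDv.
Qed.

Lemma Nstar_open (B : set nat) : open [set x : Nstar | val x B].
Proof. by exists [set p : betaN | p B] => //; exact: betaN_open. Qed.

Lemma Nstar_nbhs_mem (x : Nstar) (B : set nat) :
  val x B -> nbhs x [set y : Nstar | val y B].
Proof. by move=> xB; apply: open_nbhs_nbhs; split => //; exact: Nstar_open. Qed.

Lemma Nstar_nbhs (x : Nstar) (U : set Nstar) :
  nbhs x U -> exists2 B, val x B & [set y : Nstar | val y B] `<=` U.
Proof.
rewrite nbhsE => -[_ [[W oW <-] Wx] WU].
have /betaN_nbhs[B xB BW] : nbhs (val x) W by exact: open_nbhs_nbhs.
by exists B => // y yB; apply: WU; exact: BW.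
Qed.

Lemma Nstar_separation (R : realType) (h : Nstar -> R) : continuous h ->
  exists C : set nat, forall B : set nat,
    ((forall x : Nstar, val x B -> 1 <= h x) -> finite_set (B `\` C)) /\
    ((forall x : Nstar, val x B -> h x <= -1) -> finite_set (B `&` C)).
Proof.
move=> ch.
pose Z := [set x | 1 <= h x].
pose D := [set B : set nat | forall x : Nstar, val x B -> 0 < h x].
pose F := filter_from D (fun B => Z `\` [set x : Nstar | val x B]).
suff [C DC ZC] : exists2 C, D C & forall x, Z x -> val x C.
  exists C => B; split => hB.
    apply: contrapT => /Nstar_mem_infinite[x xBC].
    have xC : val x C by apply: ZC; apply: hB; apply: filterS xBC => n [].
    by have /filter_ex[n [[_ nC]]] : ultra (val x) ((B `\` C) `&` C)
      by exact: filterI.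
  apply: contrapT => /Nstar_mem_infinite[x xBC].
  have h_gt0 : 0 < h x by apply: DC; apply: filterS xBC => n [].
  have h_le : h x <= -1 by apply: hB; apply: filterS xBC => n [].
  lra.
apply: contrapT => nC.
have FF : ProperFilter F.
  apply: filter_from_proper.
    apply: filter_from_filter.
      by exists set0 => x /filter_ex[].
    move=> B B' DB DB'; exists (B `|` B').
      move=> x xBB'; have [/DB//|/betaN_setC xB] := pselect (val x B).
      apply: DB'; apply: filterS (filterI xBB' xB).
      by move=> n [[]].
    move=> x [Zx xBB']; split; split=> // xB; apply: xBB'; apply: filterS xB.
      by left.
    by right.
  move=> B DB; apply: contrapT => ZB; apply: nC; exists B => // x Zx.
  by apply: contrapT => xB; apply: ZB; exists x.
have cZ : compact Z.
  apply: (subclosed_compact _ Nstar_compact) => //.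
  by apply: (closed_comp _ (@closed_ge R 1)) => x _; exact: ch.
have [|x [Zx Fx]] := cZ F FF.
  by exists set0 => [x /filter_ex[]|x []].
have : nbhs x (h @^-1` [set y | 0 < y]).
  by apply: ch; apply: lt_nbhsr; exact: lt_le_trans Zx.
move=> /Nstar_nbhs[B xB BU].
have [||y [[_ yB] //]] := Fx (Z `\` [set y : Nstar | val y B]) [set y : Nstar | val y B].
  by exists B.
exact: Nstar_nbhs_mem.
Qed.

(** * Functions on the one-point compactification of a discrete space *)

Definition alexandroff (I : choiceType) : topologicalType :=
  one_point_compactification (discrete_topology I).

Lemma alexandroff_compact (I : choiceType) : compact [set: alexandroff I].
Proof. exact: one_point_compactification_compact. Qed.

Lemma compact_discrete_finite (T : discreteTopologicalType) (C : set T) :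
  compact C -> finite_set C.
Proof.
move=> cC; apply: contrapT => Cinf.
have [|x [Cx Fx]] := cC _ (cofinite_in_proper Cinf).
  by rewrite /= setDv.
have [||y [xy /= yx]] := Fx (~` [set x]) [set x].
- by rewrite /= setDE setCK; exact: finite_setIr.
- exact: discrete_set1.
- exact: xy.
Qed.

Lemma nbhs_infty (I : choiceType) (U : set (alexandroff I)) :
  nbhs (None : alexandroff I) U <->
  U None /\ finite_set [set i : I | ~ U (Some i)].
Proof.
split.
  move=> [C [cC _] CU]; split; first by apply: CU; right.
  apply: sub_finite_set (compact_discrete_finite cC) => i /= nU.
  by apply: contrapT => nC; apply: nU; apply: CU; left; exists i.
move=> [UN fU]; exists [set i : discrete_topology I | ~ U (Some i)].
  split; last exact: discrete_closed.
  exact: finite_compact.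
move=> x [[i /= /contrapT Ui <-]|->]; first exact: Ui.
exact: UN.
Qed.

Lemma continuous_alexandroff (R : realType) (I : choiceType)
    (f : alexandroff I -> R) :
  continuous f <->
  forall e, 0 < e -> finite_set [set i : I | e <= `|f None - f (Some i)|].
Proof.
split=> [fc e e0|ff].
  have [dist_lt _] := @cvgrPdist_lt _ _ _ (nbhs (None : alexandroff I)) _ f (f None).
  have /nbhs_infty[_] := dist_lt (fc None) e e0.
  by apply: sub_finite_set => i /= ei; rewrite ltNge ei.
move=> x.
have [_] := @cvgrPdist_lt _ _ _ (nbhs (x : alexandroff I)) _ f (f x); apply.
move=> e e0; case: x => [i|].
  by apply/principal_filterP; rewrite /= subrr normr0.
apply/nbhs_infty; split; first by rewrite subrr normr0.
by apply: sub_finite_set (ff e e0) => i /= /negP; rewrite -leNgt.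
Qed.

Lemma ratr_approx (R : realType) (y e : R) : 0 < e ->
  exists q : rat, `|y - ratr q| < e.
Proof.
move=> e0; have [|q] := @rat_in_itvoo R (y - e) (y + e); first by lra.
by rewrite in_itv/= => /andP[? ?]; exists q; rewrite ltr_norml; lra.
Qed.

Section density_bound.
Variables (R : realType) (I : choiceType) (A : I -> set nat).
Variable below : I -> set I.
Hypothesis AL : luzin_system A below.

Local Notation X := (cfun R (@alexandroff_compact I)).

Lemma luzin_directed (S : set I) : finite_set S -> exists a, S `<=` below a.
Proof.
move=> /finite_seqP[s ->]; elim: s => [|x s [a sa]].
  have [a _] : [set: I] !=set0.
    by apply/set0P/eqP => I0; apply: (luzin_uncountable AL); rewrite I0.
  by exists a => j.
have ss j : j \in x :: s -> j = x \/ below a j.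
  by rewrite inE => /orP[/eqP|/sa]; [left|right].
have [xa|ax] := luzin_below_total AL x a.
  exists a => j /ss[->|//]; apply: xa; exact: luzin_below_refl AL _.
exists x => j /ss[->|/ax//]; exact: luzin_below_refl AL _.
Qed.

Lemma dens_cfun_alexandroff U (K : set U) :
  [set: I * nat] #<= K -> dens X #<= K.
Proof.
move=> IK.
have [iota iotaP] : exists iota : I -> I -> nat,
    forall a, {in below a &, injective (iota a)}.
  have /choice[iota iotaP] : forall a, exists f : I -> nat,
      {in below a &, injective f}.
    by move=> a; exact/countable_injP/(luzin_below_countable AL).
  by exists iota.
(* Rational-valued, eventually constant functions: [q] at infinity, and the
   entries of [s] at the first [size s] points of [below a]. *)
pose g (a : I) (q : rat) (s : seq rat) (x : alexandroff I) : R :=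
  if x is Some j then
    if `[< below a j >] then ratr (nth q s (iota a j)) else ratr q
  else ratr q.
have gc a q s : continuous (g a q s).
  apply/continuous_alexandroff => e e0.
  have : finite_set (below a `&` iota a @^-1` `I_(size s)).
    apply: card_le_finite (finite_II (size s)).
    have /card_eqPle[_] : iota a @` (below a `&` iota a @^-1` `I_(size s)) #=
        (below a `&` iota a @^-1` `I_(size s)).
      apply: inj_card_eq => i j /set_mem[ai _] /set_mem[aj _].
      by apply: iotaP; exact: mem_set.
    move=> /card_le_trans; apply; apply: subset_card_le => _ [i [_ ?] <-] //.
  apply: sub_finite_set => j /=; case: asboolP => [aj|_]; last first.
    by rewrite subrr normr0 leNgt e0.
  move=> ej; split => //=; rewrite ltnNge; apply/negP => sj; move: ej.
  by rewrite nth_default// subrr normr0 leNgt e0.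
pose G (w : I * (rat * seq rat)) : X := mkcfun _ (@gc w.1 w.2.1 w.2.2).
have GA (f : X) (e : R) : 0 < e -> exists w, `|f - G w| <= e.
  move=> e0; have e20 : 0 < e / 2 by lra.
  have /continuous_alexandroff/(_ _ e20) := @cfun_continuous _ _ _ f.
  set S := [set i | _] => Sf.
  have [a Sa] := luzin_directed Sf.
  have [n Sn] := finite_nat_bounded (finite_image (iota a) Sf).
  have [q fq] := ratr_approx (f None) e20.
  have [sg sgP] : exists sg : nat -> rat, forall k j,
      below a j -> iota a j = k -> `|f (Some j) - ratr (sg k)| < e.
    suff /choice[sg sgP] : forall k, exists q : rat, forall j,
        below a j -> iota a j = k -> `|f (Some j) - ratr q| < e by exists sg.
    move=> k; have [[j [aj jk]]|nj] := pselect (exists j, below a j /\ iota a j = k).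
      have [r fr] := ratr_approx (f (Some j)) e0; exists r => i ai ik.
      by rewrite (iotaP a i j) ?inE// ik jk.
    by exists 0 => j aj jk; case: nj; exists j.
  exists (a, (q, mkseq sg n)); rewrite cfun_normE; apply: sup_norm_le => [|x].
    exact: ltW.
  rewrite cfunDE cfunNE /=; case: x => [j|] /=; last by apply: ltW; lra.
  have far : ~ S j -> `|f (Some j) - ratr q| <= e.
    move=> /= /negP; rewrite -ltNge => fj.
    rewrite -(subrKA (f None)) (le_trans (ler_normD _ _))//.
    rewrite distrC; lra.
  case: asboolP => [aj|naj]; last by apply: far => /Sa.
  have [jn|nj] := ltnP (iota a j) n.
    by rewrite nth_mkseq//; apply: ltW; exact: sgP.
  rewrite nth_default ?size_mkseq//; apply: far => Sj.
  by have := Sn _ (imageP _ Sj); rewrite /= ltnNge nj.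
have dG : dense (range G).
  move=> O [f Of] oO; have : nbhs f O by exact: open_nbhs_nbhs.
  move=> /nbhs_normP[e /= e0 eO]; have e20 : 0 < e / 2 by lra.
  have [w fw] := GA f _ e20; exists (G w); split; last by exists w.
  by apply: eO => /=; apply: le_lt_trans fw _; lra.
have [_ /(_ _ dG)] := densP X; move=> /card_le_trans; apply.
apply: (@card_le_trans _ _ _ [set: I * (rat * seq rat)]).
  exact: card_image_le.
apply: card_le_trans IK.
have /card_eqPle[_] : (fun w : I * (rat * seq rat) => (w.1, choice.pickle w.2)) @`
    [set: I * (rat * seq rat)] #= [set: I * (rat * seq rat)].
  apply: inj_card_eq => -[i w] [j v] _ _ /= [->].
  by move=> /(pcan_inj choice.pickleK) ->.
by move=> /card_le_trans; apply; exact: card_leT.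
Qed.

End density_bound.

Section vanishing_at_infinity.
Variables (R : realType) (I : choiceType).
Local Notation X := (cfun R (@alexandroff_compact I)).

Definition vanishing : {pred X} := fun f : X => f None == 0.

Lemma vanishingP (f : X) : reflect (f None = 0) (f \in vanishing).
Proof. exact: eqP. Qed.

Lemma vanishing_submod_closed : subsemimod_closed vanishing.
Proof.
split; [split|].
- exact/vanishingP.
- by move=> f g /vanishingP f0 /vanishingP g0; apply/vanishingP; rewrite cfunDE f0 g0 addr0.
- by move=> a f /vanishingP f0; apply/vanishingP; rewrite cfunZE f0 mulr0.
Qed.

HB.instance Definition _ :=
  GRing.isSubmodClosed.Build R X vanishing vanishing_submod_closed.

Lemma closed_vanishing : closed [set f : X | f \in vanishing].
Proof.
move=> f clf; apply/vanishingP; apply: contrapT => f0.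
have : nbhs f (ball f `|f None|).
  by apply: nbhsx_ballx; rewrite normr_gt0; exact/eqP.
move=> /clf[g [/vanishingP g0]]; rewrite -ball_normE /=; apply/negP.
rewrite -leNgt -[leLHS]/(`|f None|) -[f None]subr0 -g0 -cfunNE -cfunDE.
exact: ler_sup_norm.
Qed.

End vanishing_at_infinity.

Section signed_embedding.
Variables (R : realType) (I : choiceType) (A : I -> set nat).
Variable below : I -> set I.
Hypothesis AL : luzin_system A below.
Variable eps : I -> R.
Hypothesis eps_norm : forall i, `|eps i| = 1.

Local Notation X := (cfun R (@alexandroff_compact I)).
Local Notation Y := (lin_subspace (@vanishing R I)).

(* The [i] with [x] in the clopen set of [A i], or infinity if there is none. *)
Definition branch (x : Nstar) : alexandroff I :=
  if pselect (exists i, val x (A i)) is left H then Some (projT1 (cid H))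
  else None.

Lemma branch_some (x : Nstar) i : val x (A i) -> branch x = Some i.
Proof.
move=> xi; rewrite /branch; case: pselect => [H|[]]; last by exists i.
have xj := projT2 (cid H); set j := projT1 _ in xj *.
congr Some; apply: contrapT => /(luzin_disjoint AL).
by apply: (@Nstar_infinite x); exact: filterI.
Qed.

Lemma branch_some_inv (x : Nstar) i : branch x = Some i -> val x (A i).
Proof.
by rewrite /branch; case: pselect => // H [<-]; exact: projT2 (cid H).
Qed.

Lemma branch_continuous : continuous branch.
Proof.
move=> x U; case bx: (branch x) => [i|].
  move=> /principal_filterP Ui; have xi := branch_some_inv bx.
  apply: (@filterS _ _ _ [set y : Nstar | val y (A i)]).
    by move=> y yi; rewrite /= (branch_some yi).
  exact: Nstar_nbhs_mem.
move=> /nbhs_infty[UN /finite_fsetP[F UF]].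
pose V := \bigcap_(i in [set` F]) ~` A i.
have xV : val x V.
  apply: filter_bigI => i _; apply/betaN_setC => /branch_some.
  by rewrite bx.
apply: (@filterS _ _ _ [set y : Nstar | val y V]).
  move=> y yV /=; case by_ : (branch y) => [i|//].
  apply: contrapT => nU; have Fi : [set` F] i by rewrite -UF.
  have /filter_ex[n [Ain /(_ i Fi)]] : ultra (val y) (A i `&` V).
    by apply: filterI => //; exact: branch_some_inv.
  by [].
exact: Nstar_nbhs_mem.
Qed.

Definition twist (f : X) (x : alexandroff I) : R :=
  if x is Some i then eps i * f (Some i) else 0.

Lemma twist_continuous (f : Y) : continuous (twist (val f)).
Proof.
apply/continuous_alexandroff => e e0.
have /vanishingP f0 := valP f.
have /continuous_alexandroff/(_ e e0) := @cfun_continuous _ _ _ (val f).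
apply: sub_finite_set => i /=.
by rewrite f0 !sub0r !normrN normrM eps_norm mul1r.
Qed.

Lemma twist_branch_continuous (f : Y) : continuous (twist (val f) \o branch).
Proof.
move=> x; apply: continuous_comp; first exact: branch_continuous.
exact: twist_continuous.
Qed.

Definition signed_embedding (f : Y) : cfun R Nstar_compact :=
  mkcfun Nstar_compact (@twist_branch_continuous f).

Lemma signed_embedding_linear : linear signed_embedding.
Proof.
move=> a f g; apply: cfunP => x; rewrite cfunDE cfunZE /=.
case: (branch x) => [i|] /=; last by rewrite mulr0 addr0.
rewrite -[LHS]/(eps i * (a *: val f + val g : X) (Some i)).
by rewrite cfunDE cfunZE mulrDr mulrCA.
Qed.

HB.instance Definition _ :=
  GRing.isLinear.Build R Y (cfun R Nstar_compact) *:%R signed_embedding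
    signed_embedding_linear.

Lemma signed_embedding_norm (f : Y) : `|signed_embedding f| <= `|f|.
Proof.
rewrite cfun_normE; apply: sup_norm_le => // x /=.
case: (branch x) => [i|] /=; last by rewrite normr0.
by rewrite normrM eps_norm mul1r norm_valE; exact: ler_sup_norm.
Qed.

End signed_embedding.

Lemma aleph1_uncountable : ~ countable (aleph 1).
Proof. by have [[_]] := card_succP (aleph 0). Qed.

Lemma card_lt_aleph_succ T (D : set T) n : D #<= aleph n -> D #< aleph n.+1.
Proof.
have [[nS Sn] _] := card_succP (aleph n); move=> Dn; split.
  exact: card_le_trans Dn nS.
by move=> SD; apply: Sn; exact: card_le_trans SD Dn.
Qed.

Section unit_functions.
Variables (R : realType) (I : choiceType).
Local Notation X := (cfun R (@alexandroff_compact I)).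

Definition const1 : X :=
  mkcfun (@alexandroff_compact I) (@cst_continuous (alexandroff I) R 1).

Definition delta_fun (i : I) (x : alexandroff I) : R :=
  if x is Some j then (if `[< j = i >] then 1 else 0) else 0.

Lemma delta_fun_continuous i : continuous (delta_fun i).
Proof.
apply/continuous_alexandroff => e e0; apply: sub_finite_set (finite_set1 i).
move=> j /=; case: asboolP => // _; by rewrite subrr normr0 leNgt e0.
Qed.

Definition delta (i : I) : X :=
  mkcfun (@alexandroff_compact I) (@delta_fun_continuous i).

Lemma delta_vanishing i : delta i \in @vanishing R I.
Proof. exact/vanishingP. Qed.

Lemma const1_delta_norm i : `|const1 - 2 *: delta i| <= 1.
Proof.
rewrite cfun_normE; apply: sup_norm_le => // x.
rewrite cfunDE cfunNE cfunZE /=.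
case: x => [j|] /=; first case: asboolP => _; rewrite ler_norml; lra.
Qed.

End unit_functions.

Theorem proposition4p5 (R : realType) :
  ~ one_injective (aleph 2) (cfun R Nstar_compact).
Proof.
move=> inj.
have [I [A [below [AL IK]]]] := luzin_system_exists aleph1_uncountable.
have [k [Pk Qk]] := luzin_split AL.
pose eps (i : I) : R := if `[< A i k >] then 1 else -1.
have eps_norm i : `|eps i| = 1.
  by rewrite /eps; case: ifP => _; rewrite ?normrN normr1.
pose t := signed_embedding AL eps_norm.
have t_le f : `|t f| <= `|f| by exact: signed_embedding_norm.
have t_bounded : bounded_fun_norm t.
  by move=> r; exists r => f; apply: le_trans; exact: t_le.
have [T [T_bounded Tt T_le]] := inj _
  (card_lt_aleph_succ (dens_cfun_alexandroff R AL IK)) _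
  (@closed_vanishing R I) t t_bounded.
have {}T_le f : `|T f| <= `|f|.
  apply: le_trans (ler_opnorm f T_bounded) _.
  rewrite ler_piMl//; apply: le_trans T_le _.
  apply: ge_sup; first by exists `|t 0|, 0 => //=; rewrite normr0.
  by move=> _ [g /= g1 <-]; exact: le_trans (t_le g) g1.
pose h := T (const1 R I).
have h_near (x : Nstar) i : val x (A i) -> `|h x - 2 * eps i| <= 1.
  move=> xi; pose d : lin_subspace (@vanishing R I) := SigSub (delta_vanishing R i).
  have Tdx : T (delta R i) x = eps i.
    rewrite (Tt d) /= (branch_some AL xi) /= /delta_fun.
    by case: asboolP => // _; rewrite mulr1.
  rewrite -Tdx -cfunZE -linearZ -cfunNE -cfunDE -linearB.
  apply: le_trans (ler_sup_norm _ _) _; apply: le_trans (T_le _) _.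
  exact: const1_delta_norm.
have [C hC] := Nstar_separation (@cfun_continuous _ _ _ h).
apply: (luzin_inseparable AL (C := C) Pk Qk) => i /= ik.
  apply: (hC (A i)).1 => x /h_near; rewrite /eps asboolT// ler_norml; lra.
apply: (hC (A i)).2 => x /h_near; rewrite /eps asboolF// ler_norml; lra.
Qed.
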